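(* Let $P=(X,\prec)$ be a finite poset of width two with $n=|X|$ elements, with a fixed partition $X=\mathcal{C}_1\sqcup\mathcal{C}_2$ into chains $\mathcal{C}_1=\{\alpha_1\prec\cdots\prec\alpha_{a}\}$, $\mathcal{C}_2=\{\beta_1\prec\cdots\prec\beta_{b}\}$. Fix $x\in X$, and for integers $j$ let $N(j)$ be the number of linear extensions $L$ of $P$ with $L(x)=j$ and $N_q(j):=\sum_{L\in\mathcal{E}(P):L(x)=j}q^{\mathrm{wgt}(L)}$. Suppose $k\in\{1,\dots,n-1\}$ and $N(k)>0$. Then the following are equivalent: (a) $N(k)^2=N(k-1)\,N(k+1)$; (b) $N(k)=N(k+1)=N(k-1)$; (c) $N_q(k)^2=N_q(k-1)\,N_q(k+1)$; (d) $N_q(k)=q^{\varepsilon}N_q(k-1)=q^{-\varepsilon}N_q(k+1)$, where $\varepsilon=1$ if $x\in\mathcal{C}_1$ and $\varepsilon=-1$ if $x\in\mathcal{C}_2$; (e) $x$ satisfies the $k$-pentagon property.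
   Context: A linear extension of $P$ is a bijection $L:X\to\{1,\dots,n\}$ with $L(u)<L(v)$ whenever $u\prec v$; $\mathcal{E}(P)$ is the set of linear extensions, and $\mathrm{wgt}(L):=\sum_{i=1}^{a}L(\alpha_i)$. Write $u\,\|\,v$ if $u,v$ are incomparable. For $x=\alpha_r\in\mathcal{C}_1$, $x$ satisfies the $k$-pentagon property if the elements $\alpha_{r-1},\alpha_{r+1},\beta_{k-r},\beta_{k-r+1}$ exist and $\alpha_{r-1}\prec\beta_{k-r}\prec\beta_{k-r+1}\prec\alpha_{r+1}$, $\alpha_r\,\|\,\beta_{k-r}$ and $\alpha_r\,\|\,\beta_{k-r+1}$ (i.e. these five elements induce a pentagon-shaped Hasse diagram). For $x=\beta_r\in\mathcal{C}_2$ the property is defined analogously with the roles of the two chains swapped: $\beta_{r-1}\prec\alpha_{k-r}\prec\alpha_{k-r+1}\prec\beta_{r+1}$, $\beta_r\,\|\,\alpha_{k-r}$, $\beta_r\,\|\,\alpha_{k-r+1}$.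
   Formalization: In the k-pentagon property, if x is the first or last element of its chain, the missing neighbour is read as an adjoined minimum or maximum (its inequality is void); requiring it to exist makes the claim false, e.g. for X={α₁}⊔{β₁≺β₂}, all α–β pairs incomparable, x=α₁, k=2. *)

(* Defs.v *)
From HB Require Import structures.
From mathcomp Require Import all_boot all_order all_algebra.

Set Implicit Arguments.
Unset Strict Implicit.
Unset Printing Implicit Defensive.

Import Order.TTheory GRing.Theory Num.Theory.

Section Poset.
Variables (d : Order.disp_t) (X : finPOrderType d).
Implicit Types (A : {set X}) (C D : seq X) (x y z : X).

Definition antichain A : bool :=
  [forall u in A, forall v in A, (u != v) ==> (u >< v)%O].

Definition width : nat := \max_(A : {set X} | antichain A) #|A|.

(* C lists a chain in increasing order: its i-th element, counted from 1, is
   the i-th item of C. *)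
Definition chain_partition C1 C2 : Prop :=
  [/\ sorted <%O%O C1, sorted <%O%O C2 & perm_eq (C1 ++ C2) (enum X)].

(* Positions are 1, ..., #|X|, whereas 'I_#|X| is 0, ..., #|X| - 1; hence the
   successor in pos. *)
Definition pos (L : {ffun X -> 'I_#|X|}) x : nat := (L x).+1.

Definition linext (L : {ffun X -> 'I_#|X|}) : bool :=
  [&& injectiveb L, [forall i, exists u, L u == i]
    & [forall u, forall v, (u < v)%O ==> (pos L u < pos L v)]].

Definition wgt C1 (L : {ffun X -> 'I_#|X|}) : nat := \sum_(u <- C1) pos L u.

Definition N x (j : nat) : nat :=
  #|[set L : {ffun X -> 'I_#|X|} | linext L && (pos L x == j)]|.

Definition Nq C1 x (j : nat) : {poly int} :=
  (\sum_(L : {ffun X -> 'I_#|X|} | linext L && (pos L x == j)) 'X^(wgt C1 L))%R.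

(* X with a least element Bot and a greatest element Top adjoined. *)
Inductive hat : Type := Bot | Elt of X | Top.

Definition lt_hat (u v : hat) : bool :=
  match u, v with
  | Bot, Elt _ | Bot, Top | Elt _, Top => true
  | Elt x, Elt y => (x < y)%O
  | _, _ => false
  end.

(* For C = [:: c_1; ...; c_m], with the convention c_0 = Bot and
   c_(m + 1) = Top: Some c_i if 0 <= i <= m + 1, and None otherwise. *)
Definition hat_nth C (i : nat) : option hat :=
  onth (rcons (Bot :: map Elt C) Top) i.

(* C_r = x, C_(r-1) < D_(k-r) < D_(k-r+1) < C_(r+1), and x is incomparable to
   D_(k-r) and D_(k-r+1).  The two elements of D are elements of X; C_(r-1) and
   C_(r+1) may be Bot and Top, i.e. the corresponding inequality is void when x
   is the first or the last element of C.  This matters: if X consists of x and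
   of a chain y < z, both incomparable to x, then N x 1 = N x 2 = N x 3 = 1.
   The truncation of r.-1 and k - r is harmless: index 0 is never an Elt. *)
Definition pentagon C D x (r k : nat) : Prop :=
  exists (p s : hat) (y z : X),
    [/\ hat_nth C r = Some (Elt x),
        hat_nth C r.-1 = Some p,
        hat_nth C r.+1 = Some s,
        hat_nth D (k - r) = Some (Elt y)
      & hat_nth D (k - r).+1 = Some (Elt z)]
    /\ [/\ lt_hat p (Elt y), (y < z)%O, lt_hat (Elt z) s,
           (x >< y)%O & (x >< z)%O].

Definition pentagon_property C1 C2 x (k : nat) : Prop :=
  exists r : nat, pentagon C1 C2 x r k \/ pentagon C2 C1 x r k.

Definition eps C1 x : int := (if x \in C1 then 1 else -1)%R.

End Poset.

(* The indeterminate q in the fraction field, so that q^-1 makes sense. *)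
Definition qfrac : {fraction {poly int}} := tofrac 'X%R.

(* Main.v *)
Require Import Defs.
From HB Require Import structures.
From mathcomp Require Import all_boot all_order all_algebra.
From mathcomp Require Import perm zify.

(** A linear extension is a lattice path through the order ideals
    [(i, j) = {alpha_1, ..., alpha_i, beta_1, ..., beta_j}].  If
    [x = alpha_(c+1)], the extensions with [L x = c + 1 + j] are the paths using
    the step [(c, j) -> (c+1, j)], so that [N x (c + 1 + j) = A j * B j], where
    [A j] counts the paths from [(0, 0)] to [(c, j)] and [B j] those from
    [(c+1, j)] to the top.  Each column of path counts is obtained from the
    previous one by restricting it to an interval and taking partial sums, which
    preserves log-concavity; moreover [A j ^ 2 = A (j-1) * A (j+1) > 0] forces
    the previous column to vanish at [j], i.e. [(c-1, j)] is not an ideal, i.e.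
    [alpha_c < beta_j].  The same applied to [B] in the opposite
    order yields [beta_(j+1) < alpha_(c+2)], so equality in (a) gives the
    pentagon.  Conversely a pentagon forces the neighbours of [x] in every [L]
    with [L x = k] to be [beta_j] and [beta_(j+1)], and exchanging [x] with a
    neighbour changes the weight by exactly one. *)

Set Implicit Arguments.
Unset Strict Implicit.
Unset Printing Implicit Defensive.

Import Order.TTheory GRing.Theory.

(** * Log-concave sequences *)

(** Stronger than [f j * f j.+2 <= f j.+1 ^ 2]: this shifted form also makes the support of [f] an
    interval, which matters because path counts have zeros. *)
Definition log_concave (f : nat -> nat) :=
  forall i m d, i <= m -> f i * f (m + d) <= f (i + d) * f m.

Lemma log_concave1 (f : nat -> nat) :
  (forall i m, i <= m -> f i * f m.+1 <= f i.+1 * f m) -> log_concave f.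
Proof.
move=> f1 i m d; elim: d i m => [|d IHd] i m le_im; first by rewrite !addn0.
have [lt_im|] := ltnP i m; last first.
  by move=> le_mi; rewrite (_ : i = m) 1?mulnC //; lia.
rewrite !addnS; apply: leq_trans (f1 _ _ _) _; first by lia.
by rewrite -addSn; exact: IHd.
Qed.

Lemma log_concave_delta0 : log_concave (fun j => (j == 0) : nat).
Proof. by move=> i m d; case: i => [|i]; case: m => [|m]; case: d. Qed.

Section PartialSums.

(** [f] and [g] model consecutive columns of path counts, and [W] the ideals in the column of [g];
    the running sum is reset to zero outside [W]. *)
Variables (W : pred nat) (f g : nat -> nat).
Hypothesis W_convex : forall i j m, i <= j -> j <= m -> W i -> W m -> W j.
Hypothesis g_rec :
  forall j, g j = if W j then f j + (if j is j'.+1 then g j' else 0) else 0.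

Let g_W j : 0 < g j -> W j.
Proof. by rewrite g_rec; case: (W j). Qed.

(** After expanding [g i.+1] and [g m.+1], the [f] terms compare by log-concavity and the [g] terms
    by induction with [d] raised by one. *)
Let partial_sum_shift : log_concave f ->
  forall i m d, i <= m -> (forall j, i <= j -> j <= m -> W j) ->
  g i * f (m + d) <= f (i + d) * g m.
Proof.
move=> lcf; elim=> [|i IHi] m d le_im Wim.
  rewrite (g_rec 0) (g_rec m) !Wim // addn0.
  apply: leq_trans (lcf 0 m d le_im) _.
  by rewrite leq_mul2l leq_addr orbT.
case: m le_im Wim => // m le_im Wim.
rewrite (g_rec i.+1) (g_rec m.+1) !Wim // ?mulnDl ?mulnDr.
apply: leq_add; first exact: lcf.
case: (posnP (g i)) => [-> // | gi_gt0].
rewrite addSnnS (addSnnS i); apply: IHi => // j le_ij le_jm.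
have [lt_ij | le_ji] := ltnP i j; first by apply: Wim; lia.
by rewrite (_ : j = i) ?g_W //; lia.
Qed.

Lemma log_concave_partial_sum : log_concave f -> log_concave g.
Proof.
move=> lcf; apply: log_concave1 => i m le_im.
case: (posnP (g i)) => [-> // | gi_gt0].
case: (posnP (g m.+1)) => [-> | gm_gt0]; first by rewrite muln0.
have Wim j : i <= j -> j <= m.+1 -> W j.
  by move=> ij jm; apply: (W_convex ij jm); exact: g_W.
rewrite (g_rec m.+1) (g_rec i.+1) !Wim //; try lia.
(* The common product [g i * g m] cancels, which leaves the shifted inequality with [d = 1]. *)
rewrite mulnDr mulnDl [X in _ <= X]addnC [X in _ <= X]addnC leq_add2r.
rewrite -addn1 -(addn1 i); apply: partial_sum_shift => // j ij jm.
by apply: Wim; lia.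
Qed.

(** Strictness arises where a run of positive [g] starts: there [g i = f i], while [g i.+1] exceeds
    [f i.+1] by [g i]. Induction carries it along the run. *)
Let partial_sum_ltn : log_concave f ->
  forall i m, i < m -> W i.+1 -> 0 < g i -> 0 < f m ->
  g i * f m.+1 < g i.+1 * f m.
Proof.
move=> lcf; elim=> [|i IHi] m lt_im Wi1 gi_gt0 fm_gt0.
  have := lcf 0 m 1 (ltnW lt_im); rewrite !addn1 => le01.
  have W0 := g_W gi_gt0.
  rewrite (g_rec 1) Wi1; move: gi_gt0; rewrite (g_rec 0) W0 addn0 => gi_gt0.
  have: 0 < f 0 * f m by rewrite muln_gt0 gi_gt0.
  by rewrite mulnDl; lia.
have := lcf i.+1 m 1 (ltnW lt_im); rewrite !addn1 => le1.
have Wi := g_W gi_gt0.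
rewrite (g_rec i.+2) Wi1 mulnDl {1}(g_rec i.+1) Wi mulnDl.
case: (posnP (g i)) => [gi0 | gi_gt0'].
  by have: 0 < g i.+1 * f m; [rewrite muln_gt0 gi_gt0 | rewrite gi0; lia].
by have := IHi _ (ltnW lt_im) Wi gi_gt0' fm_gt0; lia.
Qed.

(** Expanding [g j.+2] and one factor [g j.+1] reduces the equation to
    [g j.+1 * f j.+1 = g j * f j.+2], which the strict inequality excludes when [f j.+1 > 0]. *)
Lemma log_concave_partial_sum_eq j : log_concave f -> 0 < g j.+1 ->
  g j.+1 ^ 2 = g j * g j.+2 -> f j.+1 = 0.
Proof.
move=> lcf g1_gt0 eq_g.
have: 0 < g j * g j.+2 by rewrite -eq_g expn_gt0 g1_gt0.
rewrite muln_gt0 => /andP[g0_gt0 g2_gt0].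
apply/eqP; rewrite eqn0Ngt; apply/negP => f1_gt0.
have := partial_sum_ltn lcf (ltnSn j) (g_W g1_gt0) g0_gt0 f1_gt0.
move: eq_g; rewrite (g_rec j.+2) (g_W g2_gt0) mulnDr {1}expnS expn1.
rewrite {2}(g_rec j.+1) (g_W g1_gt0) mulnDr [X in _ + X = _]mulnC.
by move=> /eqP; rewrite eqn_add2r => /eqP ->; rewrite ltnn.
Qed.

End PartialSums.

(** * Extensions of the ideals of a union of two chains *)

Lemma sorted_take_drop (T : eqType) (lt : rel T) (C : seq T) i u v :
  transitive lt -> sorted lt C -> u \in take i C -> v \in drop i C -> lt u v.
Proof.
move=> lt_tr; rewrite sorted_pairwise // -{1}(cat_take_drop i C) pairwise_cat.
by case/andP=> /allrelP h _ /h; apply.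
Qed.

Section Extensions.

Variables (T : eqType) (lt : rel T).
Implicit Types (C D I s : seq T).

(** Linear extensions as sequences: only inversions are forbidden, since neighbours may be
    incomparable. *)
Definition exts I : seq (seq T) :=
  [seq s <- permutations I | pairwise (fun u v => ~~ lt v u) s].

(** Only relations across the chains are tested; inside sorted chains the condition is automatic. *)
Definition ideal C D i j : bool :=
  [&& i <= size C, j <= size D,
      allrel (fun u v => ~~ lt v u) (take i C) (drop j D)
    & allrel (fun u v => ~~ lt v u) (take j D) (drop i C)].

(** Empty off the ideals, so that [paths] vanishes there as the windowed partial sums require. *)
Definition iexts C D i j : seq (seq T) :=
  if ideal C D i j then exts (take i C ++ take j D) else [::].

Definition paths C D i j : nat := size (iexts C D i j).

Lemma mem_exts I s :
  (s \in exts I) = pairwise (fun u v => ~~ lt v u) s && perm_eq s I.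
Proof. by rewrite mem_filter mem_permutations. Qed.

Lemma exts_uniq I : uniq (exts I).
Proof. exact/filter_uniq/permutations_uniq. Qed.

Lemma perm_exts I J : perm_eq I J -> perm_eq (exts I) (exts J).
Proof.
move=> /permPr IJ; apply: uniq_perm => [||s]; rewrite ?exts_uniq //.
by rewrite !mem_exts IJ.
Qed.

Lemma idealC C D i j : ideal D C j i = ideal C D i j.
Proof. by rewrite /ideal andbCA; do 2 congr andb; rewrite andbC. Qed.

Lemma mem_iexts C D i j s : (s \in iexts C D i j) =
  [&& ideal C D i j, pairwise (fun u v => ~~ lt v u) s
    & perm_eq s (take i C ++ take j D)].
Proof. by rewrite /iexts; case: ideal; rewrite ?mem_exts. Qed.

Lemma iexts_uniq C D i j : uniq (iexts C D i j).
Proof. by rewrite /iexts; case: ideal; rewrite ?exts_uniq. Qed.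

Lemma mem_iextsC C D i j s : (s \in iexts D C j i) = (s \in iexts C D i j).
Proof. by rewrite !mem_iexts idealC perm_sym perm_catC perm_sym. Qed.

Lemma ideal_convex C D i j1 j j2 : j1 <= j -> j <= j2 ->
  ideal C D i j1 -> ideal C D i j2 -> ideal C D i j.
Proof.
move=> le1 le2 /and4P[hi _ /allrelP h1 _] /and4P[_ hj _ /allrelP h2].
apply/and4P; split=> //; first exact: leq_trans hj.
  apply/allrelP => u v hu hv; apply: h1 => //.
  by move: hv; rewrite -(subnK le1) -drop_drop; exact: mem_drop.
apply/allrelP => u v hu hv; apply: h2 => //.
by move: hu; rewrite -(minn_idPl le2) take_min; exact: mem_take.
Qed.

Section Rec.

Hypotheses (lt_irr : irreflexive lt) (lt_tr : transitive lt).

Section OneSided.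

Variables (C D : seq T) (x0 : T).
Hypotheses (sC : sorted lt C) (sD : sorted lt D).

(** The obstruction is an element of [take j D] above the removed element of [C]; the last element
    of [take j D] is then above it too. *)
Lemma ideal_predPn i j : ideal C D i.+1 j -> ~~ ideal C D i j ->
  exists2 j', j = j'.+1 & lt (nth x0 C i) (nth x0 D j').
Proof.
move=> /and4P[hi hj h1 h2]; rewrite /ideal (ltnW hi) hj /= negb_and.
rewrite (drop_nth x0 hi) allrel_consr h2 andbT.
have -> /= : allrel (fun u v => ~~ lt v u) (take i C) (drop j D).
  by move: h1; rewrite (take_nth x0 hi) -cats1 allrel_catl => /andP[].
rewrite -has_predC => /hasP[v v_j /=]; rewrite negbK => lt_v.
case: j hj v_j {h1 h2} => [|j] hj; first by rewrite take0.
rewrite (take_nth x0 hj) mem_rcons inE => v_j; exists j => //.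
case/predU1P: v_j => [<- // | v_j]; apply: lt_tr lt_v _.
apply: sorted_take_drop v_j _ => //.
by rewrite (drop_nth x0 hj) mem_head.
Qed.

(** [nth x0 C i] may come last when nothing in [take j D] is above it, and this is just what an
    ideal at [(i, j)] requires beyond one at [(i + 1, j)]. *)
Lemma iexts_rcons i j t : ideal C D i.+1 j ->
  (rcons t (nth x0 C i) \in iexts C D i.+1 j) = (t \in iexts C D i j).
Proof.
move=> Vi; rewrite !mem_iexts Vi /= pairwise_rcons.
case/and4P: Vi => hi hj h1 h2.
rewrite (take_nth x0 hi) cat_rcons perm_sym -cat1s perm_catCA /=.
rewrite perm_sym perm_rcons perm_cons.
case tI: (perm_eq t _); rewrite ?andbF // !andbT; congr (_ && _).
rewrite /ideal (ltnW hi) hj (drop_nth x0 hi) allrel_consr h2 andbT /=.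
have -> /= : allrel (fun u v => ~~ lt v u) (take i C) (drop j D).
  by move: h1; rewrite (take_nth x0 hi) -cats1 allrel_catl => /andP[].
rewrite (eq_all_r (perm_mem tI)) all_cat.
suff -> : all (fun v => ~~ lt (nth x0 C i) v) (take i C) by [].
apply/allP => u u_i; apply/negP => lt_u.
have/(sorted_take_drop lt_tr sC u_i): nth x0 C i \in drop i C.
  by rewrite (drop_nth x0 hi) mem_head.
by move/(lt_tr lt_u); rewrite lt_irr.
Qed.

Lemma iexts_last i j t m : rcons t m \in iexts C D i j -> m \in take i C ->
  exists2 i', i = i'.+1 & m = nth x0 C i'.
Proof.
rewrite mem_iexts pairwise_rcons => /and3P[/and4P[hi _ _ _] /andP[mt _] tI].
case: i hi tI => [|i] hi tI; first by rewrite take0.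
rewrite (take_nth x0 hi) mem_rcons inE => /predU1P[-> | m_i]; first by exists i.
(* The top of [take i.+1 C] is now above [m], so it cannot precede [m] in the sequence. *)
have lt_m: lt m (nth x0 C i).
  apply: sorted_take_drop m_i _ => //.
  by rewrite (drop_nth x0 hi) mem_head.
have : nth x0 C i \in rcons t m.
  by rewrite (perm_mem tI) mem_cat (take_nth x0 hi) mem_rcons mem_head.
rewrite mem_rcons inE => /predU1P[eq_m | /(allP mt)]; last by rewrite lt_m.
by rewrite eq_m lt_irr in lt_m.
Qed.

End OneSided.

Variables (C D : seq T).
Hypotheses (sC : sorted lt C) (sD : sorted lt D) (uCD : uniq (C ++ D)).

Lemma paths00 : paths C D 0 0 = 1.
Proof. by rewrite /paths /iexts /ideal !take0. Qed.

Lemma paths_rec i j : ideal C D i j -> 0 < i + j ->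
  paths C D i j = (if i is i'.+1 then paths C D i' j else 0) +
                  (if j is j'.+1 then paths C D i j' else 0).
Proof.
move=> Vij ij_gt0.
have [x0 _]: exists x0 : T, true.
  case/and4P: (Vij) => hi hj _ _.
  by case: (C) (D) hi hj => [|c ?] [|e ?] /= hi hj; [lia|exists e|exists c..].
have VDC := Vij; rewrite -idealC in VDC.
(* Extensions are classified by their last element: the top of [take i C] or the top of
   [take j D]. *)
pose LC := if i is i'.+1 then [seq rcons s (nth x0 C i') | s <- iexts C D i' j]
           else [::].
pose LD := if j is j'.+1 then [seq rcons s (nth x0 D j') | s <- iexts C D i j']
           else [::].
have rconsI m : injective (rcons ^~ m : seq T -> seq T).
  by move=> s t /rcons_inj[].
transitivity (size (LC ++ LD)); last first.
  by rewrite size_cat /LC /LD; case: (i) (j) => [|?] [|?]; rewrite ?size_map.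
apply/perm_size/uniq_perm; first exact: iexts_uniq.
  have uC: uniq LC.
    by rewrite /LC; case: (i) => // i'; rewrite map_inj_uniq ?iexts_uniq.
  have uD: uniq LD.
    by rewrite /LD; case: (j) => // j'; rewrite map_inj_uniq ?iexts_uniq.
  rewrite cat_uniq uC uD andbT; apply/hasPn => s.
  rewrite /LC /LD; case: (j) (i) Vij => [|j'] [|i'] // Vij /mapP[t _ ->].
  apply/mapP => -[t' _ /rcons_inj[_ eq_nth]].
  case/and4P: Vij => hi hj _ _.
  move: uCD; rewrite cat_uniq => /and3P[_ /hasPn h _].
  by have := h _ (mem_nth x0 hj); rewrite eq_nth /= mem_nth.
move=> s; rewrite mem_cat; apply/idP/orP => [|[]].
- case/lastP: s => [|t m] ht.
    move: ht; rewrite mem_iexts /= => /andP[_ /perm_size /=].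
    rewrite size_cat !size_take_min; case/and4P: Vij; lia.
  have: m \in take i C ++ take j D.
    move: (ht); rewrite mem_iexts => /and3P[_ _ /perm_mem <-].
    by rewrite mem_rcons mem_head.
  rewrite mem_cat => /orP[m_i | m_j].
    have [i' Ei Em] := iexts_last x0 sC ht m_i; left; rewrite /LC Ei Em.
    by apply: map_f; rewrite -(iexts_rcons x0 sC) -Ei // -Em.
  move: ht; rewrite -mem_iextsC => ht.
  have [j' Ej Em] := iexts_last x0 sD ht m_j; right; rewrite /LD Ej Em.
  by apply: map_f; rewrite -mem_iextsC -(iexts_rcons x0 sD) -Ej // -Em.
- rewrite /LC; case: (i) Vij => // i' Vij /mapP[t ht ->].
  by rewrite iexts_rcons.
- rewrite /LD; case: (j) VDC => // j' VDC /mapP[t ht ->].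
  by rewrite -mem_iextsC iexts_rcons // mem_iextsC.
Qed.

(** Induction on [i + j]: a nonempty ideal has an ideal predecessor, since otherwise the tops of
    [take i C] and [take j D] would lie below each other. *)
Lemma paths_gt0 i j : (0 < paths C D i j) = ideal C D i j.
Proof.
apply/idP/idP; first by rewrite /paths /iexts; case: ideal.
have [n] := ubnP (i + j); elim: n i j => // n IHn i j lt_n Vij.
have [|ij_gt0] := posnP (i + j).
  by move/eqP; rewrite addn_eq0 => /andP[/eqP-> /eqP->]; rewrite paths00.
have [x0 _]: exists x0 : T, true.
  case/and4P: (Vij) => hi hj _ _.
  by case: (C) (D) hi hj => [|c ?] [|e ?] /= hi hj; [lia|exists e|exists c..].
have step_i i' : i = i'.+1 -> ideal C D i' j -> 0 < paths C D i j.
  move=> Ei V'; rewrite paths_rec // addn_gt0 Ei.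
  by rewrite IHn //; lia.
have step_j j' : j = j'.+1 -> ideal C D i j' -> 0 < paths C D i j.
  move=> Ej V'; rewrite paths_rec // addn_gt0 Ej.
  by rewrite [X in _ || X]IHn ?orbT //; lia.
have [Ei | /prednK/esym Ei] := posnP i.
  have /prednK/esym Ej : 0 < j by rewrite Ei in ij_gt0.
  apply: (step_j _ Ej); apply: contraT; rewrite -idealC => nV.
  have VS: ideal D C j.-1.+1 i by rewrite -Ej idealC.
  by have [i'] := ideal_predPn x0 sC VS nV; rewrite Ei.
set i' := i.-1 in Ei.
have [V' | nV] := boolP (ideal C D i' j); first exact: (step_i _ Ei).
have VS: ideal C D i'.+1 j by rewrite -Ei.
have [j' Ej lt_ij] := ideal_predPn x0 sD VS nV.
apply: (step_j _ Ej); apply: contraT; rewrite -idealC => nV'.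
have VS': ideal D C j'.+1 i by rewrite -Ej idealC.
have [i'' Ei' lt_ji] := ideal_predPn x0 sC VS' nV'.
move: Ei'; rewrite Ei => -[Ei']; rewrite -Ei' in lt_ji.
by have := lt_tr lt_ij lt_ji; rewrite lt_irr.
Qed.

Lemma paths_col i j : paths C D i.+1 j = if ideal C D i.+1 j then
  paths C D i j + (if j is j'.+1 then paths C D i.+1 j' else 0) else 0.
Proof.
by case: ifP => [V | /negbT]; [rewrite paths_rec | rewrite -paths_gt0; lia].
Qed.

(** The delta at [0] plays the role of a column before the first, so that column [0] obeys the same
    recursion. *)
Lemma paths_col0 j : paths C D 0 j = if ideal C D 0 j then
  (j == 0) + (if j is j'.+1 then paths C D 0 j' else 0) else 0.
Proof.
case: ifP => [V | /negbT]; last by rewrite -paths_gt0; lia.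
by case: j V => [|j] V; [rewrite paths00 | rewrite paths_rec].
Qed.

Lemma paths_log_concave i : log_concave (paths C D i).
Proof.
elim: i => [|i IHi].
  apply: (log_concave_partial_sum _ paths_col0) log_concave_delta0.
  by move=> i j m; exact: ideal_convex.
apply: (log_concave_partial_sum _ (paths_col i)) IHi.
by move=> ? ? ?; exact: ideal_convex.
Qed.

Lemma paths_sqr_ge i j :
  paths C D i j * paths C D i j.+2 <= paths C D i j.+1 ^ 2.
Proof.
by have := paths_log_concave i 1 (leqnSn j); rewrite !addn1 expnS expn1.
Qed.

Lemma paths_sqr_eq x0 i j : 0 < paths C D i.+1 j.+1 ->
  paths C D i.+1 j.+1 ^ 2 = paths C D i.+1 j * paths C D i.+1 j.+2 ->
  lt (nth x0 C i) (nth x0 D j).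
Proof.
move=> p_gt0 eq_p.
have := log_concave_partial_sum_eq (paths_col i) (paths_log_concave i) p_gt0 eq_p.
(* Column [i] vanishes at [j.+1], so [(i, j + 1)] is not an ideal although [(i + 1, j + 1)] is. *)
move/eqP; rewrite eqn0Ngt paths_gt0 => nV; rewrite paths_gt0 in p_gt0.
by have [_ [<-]] := ideal_predPn x0 sD p_gt0 nV.
Qed.

End Rec.

End Extensions.

(** * Order duality and complements of ideals *)

Definition converse (T : Type) (lt : rel T) : rel T := fun u v => lt v u.

Lemma pairwise_rev (T : Type) (r : rel T) s :
  pairwise r (rev s) = pairwise (converse r) s.
Proof.
elim: s => //= u s IHs; rewrite rev_cons pairwise_rcons IHs.
by rewrite all_rev.
Qed.

Section Dual.

Variables (T : eqType) (lt : rel T).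
Implicit Types (C D I s : seq T).

Lemma mem_exts_dual I s : (s \in exts (converse lt) I) = (rev s \in exts lt I).
Proof. by rewrite !mem_exts pairwise_rev perm_rev. Qed.

Lemma size_exts_dual I J : perm_eq I J ->
  size (exts (converse lt) I) = size (exts lt J).
Proof.
move=> /perm_exts/perm_size->; rewrite -(size_map rev).
apply/perm_size/uniq_perm; rewrite ?exts_uniq //.
  by rewrite (map_inj_uniq (can_inj revK)) exts_uniq.
by move=> s; rewrite -[s in RHS]revK (mem_map (can_inj revK)) mem_exts_dual.
Qed.

Lemma ideal_dual C D i j : i <= size C -> j <= size D ->
  ideal (converse lt) (rev C) (rev D) (size C - i) (size D - j) =
  ideal lt C D i j.
Proof.
move=> hi hj; rewrite /ideal !size_rev !leq_subr hi hj /=.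
rewrite !take_rev !drop_rev !subKn // !allrel_rev2.
by rewrite andbC; congr (_ && _); rewrite allrelC.
Qed.

(** Complements of ideals are ideals of the reversed order, so the ways to continue from an ideal to
    the top are again a path count. *)
Lemma paths_dual C D i j : i <= size C -> j <= size D ->
  paths (converse lt) (rev C) (rev D) (size C - i) (size D - j) =
  if ideal lt C D i j then size (exts lt (drop i C ++ drop j D)) else 0.
Proof.
move=> hi hj; rewrite /paths /iexts ideal_dual //; case: ideal => //.
apply: size_exts_dual; rewrite !take_rev !subKn //.
by apply: perm_cat; rewrite perm_rev.
Qed.

End Dual.

(** * Counting linear extensions by the position of an element *)

(** Splits equality in a product of two log-concavity inequalities into equality in each. *)
Lemma leq_mul_eq m1 m2 n1 n2 : m1 <= n1 -> m2 <= n2 -> 0 < n1 -> 0 < n2 ->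
  n1 * n2 = m1 * m2 -> n1 = m1 /\ n2 = m2.
Proof.
move=> le1 le2 n1_gt0 n2_gt0 eq12.
split; apply/eqP; rewrite eqn_leq ?le1 ?le2 andbT.
  rewrite leqNgt; apply/negP => lt1.
  by have := leq_mul (leqnn m1) le2; rewrite -eq12 leq_pmul2r // leqNgt lt1.
rewrite leqNgt; apply/negP => lt2.
by have := leq_mul le1 (leqnn m2); rewrite -eq12 leq_pmul2l // leqNgt lt2.
Qed.

Section LinearExtensions.

Variables (d : Order.disp_t) (X : finPOrderType d).
Implicit Types (C D s u v : seq X) (x y z : X) (L : {ffun X -> 'I_#|X|}).

Local Notation nlt := (fun y z : X => ~~ (z < y)%O).

Lemma chain_partitionC C D : chain_partition C D -> chain_partition D C.
Proof. by case=> sC sD pCD; split=> //; rewrite perm_catC. Qed.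

Lemma chain_partition_uniq C D : chain_partition C D -> uniq (C ++ D).
Proof. by case=> _ _ /perm_uniq->; rewrite enum_uniq. Qed.

Lemma chain_partition_mem C D y : chain_partition C D ->
  (y \in D) = (y \notin C).
Proof.
move=> cp; case: (cp) => _ _ /perm_mem/(_ y); rewrite mem_cat mem_enum inE.
have := chain_partition_uniq cp; rewrite cat_uniq => /and3P[_ /hasPn h _].
by case yD: (y \in D); [move/h: yD => /= /negbTE-> | rewrite orbF => ->].
Qed.

Lemma linext_inj L : linext L -> injective L.
Proof. by case/and3P=> /injectiveP. Qed.

Lemma linext_lt L y z : linext L -> (y < z)%O -> L y < L z.
Proof.
by case/and3P=> _ _ /forallP/(_ y)/forallP/(_ z)/implyP h /h; rewrite ltnS.
Qed.

Lemma linext_of L : injective L -> (forall y z, (y < z)%O -> L y < L z) ->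
  linext L.
Proof.
move=> injL ltL; apply/and3P; split; first exact/injectiveP.
  apply/forallP => i; apply/existsP.
  have [g _ gK] : bijective L by apply: inj_card_bij; rewrite ?card_ord.
  by exists (g i); rewrite gK.
by apply/forallP=> y; apply/forallP=> z; apply/implyP=> /ltL; rewrite ltnS.
Qed.

Lemma pairwise_index s y z : pairwise nlt s -> y \in s -> z \in s ->
  (y < z)%O -> index y s < index z s.
Proof.
move=> /(pairwiseP y) ps ys zs lt_yz; case: ltngtP => // [lt_i | eq_i].
  have := ps _ _ _ _ lt_i; rewrite !inE !index_mem !nth_index // lt_yz.
  by move=> /(_ zs ys).
have := nth_index y ys; rewrite eq_i nth_index // => eq_zy.
by rewrite eq_zy ltxx in lt_yz.
Qed.

Lemma linext_seq L : linext L ->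
  exists s, [/\ perm_eq s (enum X), pairwise nlt s & forall y, index y s = L y].
Proof.
move=> linL; have injL := linext_inj linL.
have [g LK gK] : bijective L by apply: inj_card_bij; rewrite ?card_ord.
have index_s y : index y (map g (enum 'I_#|X|)) = L y.
  by rewrite -{1}(LK y) (index_map (can_inj gK)) index_enum_ord.
exists (map g (enum 'I_#|X|)); split=> //.
  apply: uniq_perm; rewrite ?enum_uniq ?(map_inj_uniq (can_inj gK)) ?enum_uniq //.
  by move=> y; rewrite -{1}(LK y) map_f mem_enum.
have us: uniq (map g (enum 'I_#|X|)).
  by rewrite (map_inj_uniq (can_inj gK)) enum_uniq.
case: (posnP #|X|) => [X0 | X_gt0].
  by have -> : enum 'I_#|X| = [::] by apply: size0nil; rewrite size_enum_ord.
have x0 : X by exact: g (Ordinal X_gt0).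
apply/(pairwiseP x0) => i j; rewrite !inE => hi hj lt_ij.
apply/negP => /(linext_lt linL); rewrite -!index_s !index_uniq //.
by rewrite ltnNge ltnW.
Qed.

Lemma hat_nthS (E : seq X) i y :
  hat_nth E i.+1 = Some (Elt y) <-> onth E i = Some y.
Proof.
rewrite /hat_nth /= -cats1 onth_cat size_map onth_map.
have [hi | hi] := ltnP.
  by case: (onth E i) => [z|] //=; split=> -[->].
rewrite (onth_default hi); split=> //.
by case: (i - size E) => [|[]].
Qed.

Lemma hat_nth_nth (E : seq X) x0 i : i < size E ->
  hat_nth E i.+1 = Some (Elt (nth x0 E i)).
Proof.
move=> hi; apply/hat_nthS.
by have := onthTE E i; rewrite hi -(odflt_onth x0); case: onth.
Qed.

Lemma hat_nth_Elt (E : seq X) x0 i y : hat_nth E i = Some (Elt y) ->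
  exists i', [/\ i = i'.+1, i' < size E & y = nth x0 E i'].
Proof.
case: i => [//|i] /hat_nthS Ei; exists i; split=> //.
  by rewrite -onthTE Ei.
by rewrite (onth_nth x0 _ _ _ Ei).
Qed.

Lemma hat_nth_Top (E : seq X) : hat_nth E (size E).+1 = Some (@Top _ X).
Proof. by rewrite /hat_nth /= -cats1 onth_cat size_map ltnn subnn. Qed.

(** * Splitting linear extensions at an element of one chain *)

Section OneSided.

Variables (C D : seq X).
Hypothesis cp : chain_partition C D.

(** Within a chain, having no inversions and no repetitions means being increasing, and a sorted
    sequence is determined by its elements. *)
Lemma filter_chain (E s : seq X) : sorted <%O%O E -> perm_eq s (enum X) ->
  pairwise nlt s -> filter (mem E) s = E.
Proof.
move=> sE sX ps; apply: (irr_sorted_eq (@lt_trans _ X) (@ltxx _ X)) => //.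
- rewrite sorted_pairwise; last exact: lt_trans.
  have: pairwise [rel y z | (y != z) && ~~ (z < y)%O] (filter (mem E) s).
    apply: pairwise_filter; rewrite (pairwise_relI [rel y z | y != z]) ps andbT.
    by rewrite -uniq_pairwise (perm_uniq sX) enum_uniq.
  apply: (@sub_in_pairwise _ (mem E)); last exact: filter_all.
  move=> y z yE zE /= /andP[ne_yz nlt_zy].
  have lt_E := sorted_ltn_index lt_trans sE.
  case: (ltngtP (index y E) (index z E)) =>
    [/(lt_E _ _ yE zE)// | /(lt_E _ _ zE yE) | eq_i].
    by rewrite (negbTE nlt_zy).
  have := nth_index y yE; rewrite eq_i nth_index // => eq_zy.
  by rewrite eq_zy eqxx in ne_yz.
- by move=> y; rewrite mem_filter /= (perm_mem sX) mem_enum andbT.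
Qed.

(** The subsequences of [u ++ x :: v] on [C] and [D] are [C] and [D] themselves, so [u] holds
    initial segments of both; [j] counts the elements of [D] in [u]. *)
Lemma linseq_split x c u v : x = nth x C c -> c < size C ->
  perm_eq (u ++ x :: v) (enum X) -> pairwise nlt (u ++ x :: v) ->
  exists j, [/\ size u = c + j, j <= size D, perm_eq u (take c C ++ take j D)
              & perm_eq v (drop c.+1 C ++ drop j D)].
Proof.
move=> Ex hc sX ps; case: (cp) => sC sD _.
have Cx : x \in C by rewrite Ex mem_nth.
have uC : uniq C by have := chain_partition_uniq cp; rewrite cat_uniq => /andP[].
have us : uniq (u ++ x :: v) by rewrite (perm_uniq sX) enum_uniq.
have xu : x \notin u.
  by move: us; rewrite cat_uniq => /and3P[_ /hasPn h _]; apply: h; rewrite mem_head.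
have := filter_chain sC sX ps; rewrite filter_cat /= Cx => EC.
have := filter_chain sD sX ps; rewrite filter_cat /=.
rewrite (chain_partition_mem _ cp) Cx /= => ED.
have fD w : filter (mem D) w = filter (predC (mem C)) w.
  by apply: eq_filter => y /=; rewrite (chain_partition_mem _ cp).
have Ec : size (filter (mem C) u) = c.
  have := index_uniq x hc uC; rewrite -Ex -{1}EC index_cat mem_filter.
  by rewrite (negbTE xu) andbF /= eqxx addn0.
have uE : perm_eq u (filter (mem C) u ++ filter (mem D) u).
  by rewrite fD perm_sym perm_filterC.
have vE : perm_eq v (filter (mem C) v ++ filter (mem D) v).
  by rewrite fD perm_sym perm_filterC.
exists (size (filter (mem D) u)); split.
- by rewrite {1}(perm_size uE) size_cat Ec.
- by rewrite -{2}ED size_cat leq_addr.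
- by rewrite -{1}EC -{2}ED -Ec !take_size_cat.
- by rewrite -{1}EC -{2}ED -Ec -cat_rcons -(size_rcons _ x) !drop_size_cat.
Qed.

Variables (x : X) (c : nat).
Hypotheses (Ex : x = nth x C c) (hc : c < size C).

(** The paths using the step from [(c, j)] to [(c + 1, j)]; the two halves are chosen independently,
    whence a product of counts. *)
Definition split_exts j : seq (seq X) :=
  [seq u ++ x :: v | u <- iexts <%O%O C D c j,
     v <- if ideal <%O%O C D c.+1 j
          then exts <%O%O (drop c.+1 C ++ drop j D) else [::]].

Let drop_x : drop c C = x :: drop c.+1 C.
Proof. by rewrite (drop_nth x hc) -Ex. Qed.

Let take_x : take c.+1 C = rcons (take c C) x.
Proof. by rewrite (take_nth x hc) -Ex. Qed.

Lemma mem_split_exts j s : (s \in split_exts j) =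
  [&& perm_eq s (enum X), pairwise nlt s & index x s == c + j].
Proof.
case: (cp) => sC sD pCD.
apply/allpairsP/and3P => [[[u v] /= []] | [sX ps /eqP Ei]].
  rewrite mem_iexts => /and3P[/and4P[_ hj r1 r2] pu uE].
  case: ifP => // /and4P[_ _ r3 r4]; rewrite mem_exts => /andP[pv vE] Es.
  have sX : perm_eq s (enum X).
    apply: perm_trans pCD; rewrite Es.
    apply: perm_trans (perm_cat uE (_ : perm_eq (x :: v) (x :: _))) _.
      by rewrite perm_cons; exact: vE.
    rewrite -{3}(cat_take_drop c C) -{3}(cat_take_drop j D) drop_x -!catA.
    by rewrite perm_cat2l -!cat_cons perm_catCA.
  split=> //.
    rewrite Es pairwise_cat pu /= pv andbT; apply/andP; split.
      (* Pairs in one chain are handled by sortedness, pairs across the chains by the ideal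
         [(c, j)]. *)
      apply/allrelP => y z; rewrite (perm_mem uE) inE (perm_mem vE) !mem_cat.
      rewrite orbA -in_cons -drop_x => /orP[yC | yD] /orP[zC | zD].
      - by rewrite lt_gtF // (sorted_take_drop _ sC yC zC) //; exact: lt_trans.
      - exact: (allrelP r1).
      - exact: (allrelP r2).
      - by rewrite lt_gtF // (sorted_take_drop _ sD yD zD) //; exact: lt_trans.
    apply/allP => z; rewrite (perm_mem vE) mem_cat => /orP[zC | zD].
      have xC : x \in take c.+1 C by rewrite take_x mem_rcons mem_head.
      by rewrite lt_gtF // (sorted_take_drop _ sC xC zC) //; exact: lt_trans.
    by apply: (allrelP r3) => //; rewrite take_x mem_rcons mem_head.
  have us : uniq s by rewrite (perm_uniq sX) enum_uniq.
  rewrite Es index_cat ifN; last first.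
    move: us; rewrite Es cat_uniq => /and3P[_ /hasPn h _].
    by apply: h; rewrite mem_head.
  rewrite /= eqxx addn0 (perm_size uE) size_cat !size_takel // ltnW //.
have xs : x \in s by rewrite (perm_mem sX) mem_enum.
have Es : s = take (c + j) s ++ x :: drop (c + j).+1 s.
  rewrite -[X in _ ++ X :: _](nth_index x xs) Ei -drop_nth ?cat_take_drop //.
  by rewrite -Ei index_mem.
have su : size (take (c + j) s) = c + j by rewrite size_takel // -Ei index_size.
have sX' := sX; have ps' := ps; rewrite Es in sX' ps'.
have [j' []] := linseq_split Ex hc sX' ps'; rewrite su => /addnI <- hj uE vE.
exists (take (c + j) s, drop (c + j).+1 s); split=> //=.
- move: ps'; rewrite pairwise_cat => /and3P[/allrelP r pu _].
  rewrite mem_iexts pu uE !andbT /ideal (ltnW hc) hj /=.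
  apply/andP; split; apply/allrelP => y z hy hz; apply: r.
  + by rewrite (perm_mem uE) mem_cat hy.
  + by rewrite inE (perm_mem vE) mem_cat hz !orbT.
  + by rewrite (perm_mem uE) mem_cat hy orbT.
  + by rewrite inE (perm_mem vE) mem_cat orbA -in_cons -drop_x hz.
- rewrite -cat_rcons in ps'.
  move: ps'; rewrite pairwise_cat => /and3P[/allrelP r _ pv].
  rewrite ifT ?mem_exts ?pv //.
  rewrite /ideal hc hj /=.
  apply/andP; split; apply/allrelP => y z hy hz; apply: r.
  + rewrite mem_rcons inE (perm_mem uE) mem_cat.
    by move: hy; rewrite take_x mem_rcons inE orbA => ->.
  + by rewrite (perm_mem vE) mem_cat hz orbT.
  + by rewrite mem_rcons inE (perm_mem uE) mem_cat hy !orbT.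
  + by rewrite (perm_mem vE) mem_cat hz.
Qed.

Lemma N_split_exts j : N x (c.+1 + j) = size (split_exts j).
Proof.
(* The default [enum_rank x] is never reached for permutations of [enum X], whose indices are all
   below [#|X|]. *)
pose psi (s : seq X) : {ffun X -> 'I_#|X|} :=
  [ffun y => insubd (enum_rank x) (index y s)].
have psiE s y : perm_eq s (enum X) -> psi s y = index y s :> nat.
  move=> sX; rewrite ffunE val_insubd ifT //.
  by rewrite [X in _ < X]cardE -(perm_size sX) index_mem (perm_mem sX) mem_enum.
rewrite /N cardE -(size_map psi); apply/perm_size/uniq_perm.
- exact: enum_uniq.
- rewrite map_inj_in_uniq.
    apply: allpairs_uniq; rewrite ?iexts_uniq //.
      by case: ifP; rewrite ?exts_uniq.
    move=> [u v] [u' v'] /allpairsP[[u1 v1] /= [hu1 hv1 [-> ->]]].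
    move=> /allpairsP[[u2 v2] /= [hu2 hv2 [-> ->]]] /eqP.
    (* All left halves have the same length, so the concatenation determines both halves. *)
    rewrite eqseq_cat; first by case/andP=> /eqP-> /eqP[->].
    move: hu1 hu2; rewrite !mem_iexts => /and3P[_ _ /perm_size->].
    by move=> /and3P[_ _ /perm_size->].
  move=> s t; rewrite !mem_split_exts => /and3P[sX _ _] /and3P[tX _ _] eq_st.
  have st : size s = size t by rewrite (perm_size sX) (perm_size tX).
  apply: (@eq_from_nth _ x) => // i hi.
  have us : uniq s by rewrite (perm_uniq sX) enum_uniq.
  have := psiE _ (nth x s i) sX; rewrite eq_st psiE // index_uniq // => Ei.
  by rewrite -[in RHS]Ei nth_index // (perm_mem tX) mem_enum.
move=> L; rewrite mem_enum inE; apply/andP/mapP => [[linL /eqP posL] | [s]].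
  have [s [sX ps Is]] := linext_seq linL.
  exists s; last by apply/ffunP => y; apply: val_inj; rewrite /= psiE // Is.
  rewrite mem_split_exts sX ps Is; apply/eqP.
  by move: posL; rewrite /pos addSn => -[].
rewrite mem_split_exts => /and3P[sX ps /eqP Is] ->; split; last first.
  by rewrite /pos psiE // Is addSn.
have ms y : y \in s by rewrite (perm_mem sX) mem_enum.
apply: linext_of => [y z | y z lt_yz].
  move/(congr1 val); rewrite /= !psiE // => eq_i.
  by rewrite -(nth_index x (ms y)) eq_i nth_index.
by rewrite !psiE // pairwise_index.
Qed.

Lemma N_paths j : N x (c.+1 + j) = paths <%O%O C D c j *
  paths (converse <%O%O) (rev C) (rev D) (size C - c.+1) (size D - j).
Proof.
rewrite N_split_exts size_allpairs -/(paths _ _ _ _ _).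
have [hj | hj] := leqP j (size D); first by rewrite paths_dual //; case: ifP.
(* Here [size D - j] truncates to [0], so the vanishing has to come from the first factor. *)
suff -> : paths <%O%O C D c j = 0 by [].
by rewrite /paths /iexts /ideal (leqNgt j) hj /= andbF.
Qed.

Lemma linext_pos L : linext L -> exists j, [/\ pos L x = c.+1 + j,
  forall z, (pos L z < pos L x) = (z \in take c C ++ take j D)
  & forall z, (pos L x < pos L z) = (z \in drop c.+1 C ++ drop j D)].
Proof.
move=> linL; have [s [sX ps Is]] := linext_seq linL.
have us : uniq s by rewrite (perm_uniq sX) enum_uniq.
have ms y : y \in s by rewrite (perm_mem sX) mem_enum.
case/splitPr: {ms}(ms x) (ms) sX ps us Is => u v ms sX ps us Is.
have [j [su hj uE vE]] := linseq_split Ex hc sX ps.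
have xu : x \notin u.
  by move: us; rewrite cat_uniq => /and3P[_ /hasPn h _]; apply: h; rewrite mem_head.
have Lx : L x = size u :> nat by rewrite -Is index_cat (negbTE xu) /= eqxx addn0.
have Lz z : L z = (if z \in u then index z u else
                   size u + (if z == x then 0 else (index z v).+1)) :> nat.
  by rewrite -Is index_cat /= eq_sym.
exists j; split.
- by rewrite /pos Lx su addSn.
- move=> z; rewrite -(perm_mem uE) /pos ltnS Lx Lz; case: ifP => zu.
    by rewrite index_mem.
  by rewrite ltnNge leq_addr.
- move=> z; rewrite -(perm_mem vE) /pos ltnS Lx Lz; case: ifP => zu.
    rewrite ltnNge ltnW ?index_mem //=; apply/esym/negbTE.
    move: us; rewrite cat_uniq => /and3P[_ /hasPn h _].
    by apply: contraL zu => zv; apply: h; rewrite inE zv orbT.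
  have := ms z; rewrite mem_cat zu inE; case: eqVneq => [-> _ | _ /= ->].
    rewrite addn0 ltnn; apply/esym/negbTE.
    by move: us; rewrite cat_uniq => /and3P[_ _ /= /andP[]].
  by rewrite addnS ltnS leq_addr.
Qed.

Lemma N_gt0_pos k : 0 < N x k -> exists j, k = c.+1 + j.
Proof.
case/card_gt0P => L; rewrite inE => /andP[linL /eqP <-].
by have [j []] := linext_pos linL; exists j.
Qed.

(** The element [w] just before [x] lies in [take c C] or [take j.+1 D], where all elements but [y]
    are below [y]; if [w] were not [y], then [y] would sit strictly between [w] and [x]. *)
Lemma linext_pos_prev L j y : linext L -> pos L x = c.+1 + j.+1 ->
  j < size D -> y = nth x D j -> {in take c C, forall z, z < y}%O ->
  pos L x = (pos L y).+1.
Proof.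
move=> linL posx hj Ey ltC; have [j' [posx' before _]] := linext_pos linL.
have {posx'} Ej : j' = j.+1 by lia.
rewrite {j'}Ej (take_nth x hj) -Ey in before.
have y_before : pos L y < pos L x by rewrite before mem_cat mem_rcons mem_head orbT.
have [g _ gK] : bijective L.
  by apply: inj_card_bij; [exact: linext_inj | rewrite card_ord].
have hi : (L x).-1 < #|X| by rewrite (leq_ltn_trans (leq_pred _)).
pose w := g (Ordinal hi).
have posw : (pos L w).+1 = pos L x 
  by rewrite /pos /w gK /= prednK //; move: posx; rewrite /pos addSn addnS => -[->].
have: pos L w < pos L x by lia.
rewrite before mem_cat mem_rcons inE => /or3P[/ltC | /eqP <- // | wD].
  by move/(linext_lt linL); move: y_before posw; rewrite /pos; lia.
have: (w < y)%O.
  case: (cp) => _ sD _; apply: (sorted_take_drop lt_trans sD wD).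
  by rewrite (drop_nth x hj) -Ey mem_head.
by move/(linext_lt linL); move: y_before posw; rewrite /pos; lia.
Qed.

Lemma linext_pos_next L j y : linext L -> pos L x = c.+1 + j ->
  j < size D -> y = nth x D j -> {in drop c.+1 C, forall z, y < z}%O ->
  pos L y = (pos L x).+1.
Proof.
move=> linL posx hj Ey ltC; have [j' [posx' _ after]] := linext_pos linL.
have {posx'} Ej : j' = j by lia.
rewrite {j'}Ej (drop_nth x hj) -Ey in after.
have y_after : pos L x < pos L y by rewrite after mem_cat mem_head orbT.
have [g _ gK] : bijective L.
  by apply: inj_card_bij; [exact: linext_inj | rewrite card_ord].
have hi : (L x).+1 < #|X| by apply: leq_ltn_trans (ltn_ord (L y)); rewrite -ltnS.
pose w := g (Ordinal hi).
have posw : pos L w = (pos L x).+1 by rewrite /pos /w gK.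
have: pos L x < pos L w by lia.
rewrite after mem_cat inE => /or3P[/ltC | /eqP <- // | wD].
  by move/(linext_lt linL); move: y_after posw; rewrite /pos; lia.
have: (y < w)%O.
  case: (cp) => _ sD _; apply: (sorted_take_drop lt_trans sD _ wD).
  by rewrite (take_nth x hj) -Ey mem_rcons mem_head.
by move/(linext_lt linL); move: y_after posw; rewrite /pos; lia.
Qed.

(** The first ideal contains [nth x D j] but not [x], the second [x] but not [nth x D j]. *)
Lemma ideal_incomparable j : j < size D -> ideal <%O%O C D c j.+1 ->
  ideal <%O%O C D c.+1 j -> (x >< nth x D j)%O.
Proof.
move=> hj /and4P[_ _ _ /allrelP Vx] /and4P[_ _ /allrelP Vy _].
have nlt_xy : ~~ (x < nth x D j)%O.
  apply: Vx; last by rewrite drop_x mem_head.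
  by rewrite (take_nth x hj) mem_rcons mem_head.
have nlt_yx : ~~ (nth x D j < x)%O.
  apply: Vy; first by rewrite take_x mem_rcons mem_head.
  by rewrite (drop_nth x hj) mem_head.
rewrite /Order.comparable !le_eqVlt (negbTE nlt_xy) (negbTE nlt_yx) !orbF.
rewrite eq_sym orbb; have := mem_nth x hj; rewrite (chain_partition_mem _ cp).
by apply: contraNneq => ->; rewrite Ex mem_nth.
Qed.

Lemma sqr_N_pentagon k : 0 < N x k ->
  N x k ^ 2 = N x (k - 1) * N x (k + 1) -> pentagon C D x c.+1 k.
Proof.
case: (cp) => sC sD _ Nk_gt0 eq_N.
have: 0 < N x (k - 1) * N x (k + 1) by rewrite -eq_N expn_gt0 Nk_gt0.
rewrite muln_gt0 => /andP[N0_gt0 N2_gt0].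
(* Taking [j] from [k - 1] makes the positions [k - 1], [k], [k + 1] correspond to [j], [j.+1],
   [j.+2]. *)
have [j Ek] := N_gt0_pos N0_gt0.
have {Ek} Ek : k = c.+1 + j.+1 by lia.
have Ek0 : k - 1 = c.+1 + j by lia.
have Ek2 : k + 1 = c.+1 + j.+2 by lia.
have Ekr : k - c.+1 = j.+1 by lia.
move: Nk_gt0 N0_gt0 N2_gt0 eq_N; rewrite Ek2 Ek0 {1 2}Ek !N_paths !muln_gt0.
move EP: (paths _ C D c) => P; move EQ: (paths _ (rev C) (rev D) _) => Q.
move=> /andP[P1 Q1] /andP[P0 Q0] /andP[P2 Q2].
have uCD := chain_partition_uniq cp.
have dirr : irreflexive (converse (<%O : rel X)%O) by move=> y; exact: ltxx.
have dtr : transitive (converse (<%O : rel X)%O).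
  by move=> z y w yz zw; exact: lt_trans zw yz.
have dsC : sorted (converse <%O%O) (rev C) by rewrite rev_sorted.
have dsD : sorted (converse <%O%O) (rev D) by rewrite rev_sorted.
have duCD : uniq (rev C ++ rev D).
  by rewrite uniq_catC -rev_cat rev_uniq.
have V i : 0 < P i -> 0 < Q (size D - i) ->
    ideal <%O%O C D c i /\ ideal <%O%O C D c.+1 i.
  rewrite -EP -EQ !paths_gt0 //; try exact: lt_trans; try exact: ltxx.
  move=> V1; case/and4P: (V1) => _ hi _ _; rewrite ideal_dual //.
have [V0 V0'] := V _ P0 Q0; have [V1 V1'] := V _ P1 Q1; have [V2 V2'] := V _ P2 Q2.
have hj : j.+2 <= size D by case/and4P: V2.
(* Duality reverses the index: [Q] at [e], [e.+1], [e.+2] is paired with [P] at [j.+2], [j.+1],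
   [j]. *)
pose e := size D - j.+2.
have -> : size D - j.+2 = e by [].
have hj1 : j < size D by exact: ltnW.
have [he Ee0 Ee1 Ee2] : [/\ e < size D, size D - e.+1 = j.+1,
    size D - j.+1 = e.+1 & size D - j = e.+2].
  by rewrite /e; move: hj; clear; split; lia.
rewrite Ee1 Ee2 in Q0 Q1 *; rewrite expnMn mulnACA => eq_PQ.
have le_P : P j * P j.+2 <= P j.+1 ^ 2.
  by rewrite -EP; exact: (paths_sqr_ge (@ltxx _ X) lt_trans sC sD uCD).
have le_Q : Q e * Q e.+2 <= Q e.+1 ^ 2 by rewrite -EQ; exact: paths_sqr_ge.
rewrite [Q e.+2 * _]mulnC in eq_PQ.
have [eq_P eq_Q] : P j.+1 ^ 2 = P j * P j.+2 /\ Q e.+1 ^ 2 = Q e * Q e.+2.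
  by apply: leq_mul_eq eq_PQ => //; rewrite expn_gt0 ?P1 ?Q1.
exists (if c is c'.+1 then Elt (nth x C c') else @Bot _ X),
  (if c.+1 < size C then Elt (nth x C c.+1) else @Top _ X),
  (nth x D j), (nth x D j.+1); split; last split.
- rewrite Ekr; split; [ | | | exact: hat_nth_nth | exact: hat_nth_nth].
  + by rewrite (hat_nth_nth x hc) -Ex.
  + by case: (c) hc => // c' hc'; rewrite (hat_nth_nth x) // ltnW.
  + case: ltnP => hc1; first by rewrite (hat_nth_nth x).
    by rewrite (_ : c.+1 = size C) ?hat_nth_Top //; apply/eqP; rewrite eqn_leq hc.
(* For [c = 0] the lower neighbour is [Bot]; otherwise column [c] has a predecessor and the equality
   case applies. *)
- case Ec: c => [//|c'] /=; rewrite -EP Ec in eq_P P1.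
  by apply: (paths_sqr_eq (@ltxx _ X) lt_trans sC sD uCD).
- exact: (sorted_ltn_nth lt_trans).
(* If [x] is not last in [C], the equality case for the reversed chains applies, and reversing
   indices gives [nth x D j.+1] below [nth x C c.+1]. *)
- case: ltnP => //= hc1; rewrite -EQ -(subnSK hc1) in eq_Q Q1.
  have := paths_sqr_eq dirr dtr dsC dsD duCD x Q1 eq_Q.
  rewrite !nth_rev ?Ee0 ?leq_subr //; last by rewrite -subSn // subSS leq_subr.
  by rewrite -subSn // subSS subKn // ltnW.
- exact: ideal_incomparable.
- exact: ideal_incomparable.
Qed.

End OneSided.
End LinearExtensions.

(** * Exchanging neighbours *)

Section Swap.

Variables (d : Order.disp_t) (X : finPOrderType d).
Implicit Types (C D : seq X) (x y z : X) (L : {ffun X -> 'I_#|X|}).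

Definition swap x y L : {ffun X -> 'I_#|X|} := [ffun z => L (tperm x y z)].

Lemma swapK x y : involutive (swap x y).
Proof. by move=> L; apply/ffunP => z; rewrite !ffunE tpermK. Qed.

Lemma swapC x y : swap x y =1 swap y x.
Proof. by move=> L; apply/ffunP => z; rewrite !ffunE tpermC. Qed.

(** As the positions are adjacent, only the incomparable pair [x], [y] changes its relative
    order. *)
Lemma linext_swap x y L : linext L -> (x >< y)%O -> pos L y = (pos L x).+1 ->
  linext (swap x y L).
Proof.
move=> linL; rewrite /Order.comparable negb_or => /andP[nle_xy nle_yx].
rewrite /pos => -[posL].
have injL := linext_inj linL.
apply: linext_of => [z w | z w lt_zw].
  by rewrite !ffunE => /injL; exact: perm_inj.
have nltxy : (x < y)%O = false by apply: contraNF nle_xy => /ltW.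
have nltyx : (y < x)%O = false by apply: contraNF nle_yx => /ltW.
have neL z' w' : z' != w' -> L z' != L w' :> nat.
  by apply: contraNneq => /val_inj/injL ->.
rewrite !ffunE; have := linext_lt linL lt_zw.
case: tpermP lt_zw => [->|->|/eqP nzx /eqP nzy] lt_zw;
  case: tpermP lt_zw => [->|->|/eqP nwx /eqP nwy] lt_zw;
  rewrite ?ltxx ?nltxy ?nltyx in lt_zw => //.
- by move=> lt_xw; rewrite ltn_neqAle eq_sym neL //= posL.
- by rewrite posL => /ltnW.
- by rewrite posL => /ltnW.
- by rewrite posL ltnS => le_zx; rewrite ltn_neqAle neL.
Qed.

Lemma wgt_swap C x y L : uniq C -> x \in C -> y \notin C ->
  wgt C (swap x y L) + pos L x = wgt C L + pos L y.
Proof.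
move=> uC xC yC; rewrite /wgt !(big_rem x xC) /= {1}/pos ffunE tpermL -/(pos L y).
rewrite (@eq_big_seq _ _ _ _ _ (pos (swap x y L)) (pos L)); last first.
  move=> z; rewrite mem_rem_uniq // !inE => /andP[nzx zC].
  by rewrite /pos ffunE tpermD // eq_sym //; apply: contraNneq yC => <-.
by rewrite addnC [X in _ + X]addnC addnA.
Qed.

(** What makes [swap x y] a bijection between the extensions with [x] at [j] and those with [x] at
    [j.+1]. *)
Definition swappable x y j :=
  [/\ (x >< y)%O, forall L, linext L -> pos L x = j.+1 -> pos L y = j
    & forall L, linext L -> pos L x = j -> pos L y = j.+1].

Local Open Scope ring_scope.

Lemma Nq_swap C x y j : swappable x y j ->
  Nq C x j.+1 =
  \sum_(L : {ffun X -> 'I_#|X|} | linext L && (pos L x == j))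
    'X^(wgt C (swap x y L)).
Proof.
case=> incxy down up; rewrite /Nq (reindex_inj (inv_inj (swapK x y))).
apply: eq_bigl => L.
have posx : pos (swap x y L) x = pos L y by rewrite /pos ffunE tpermL.
have posy : pos (swap x y L) y = pos L x by rewrite /pos ffunE tpermR.
apply/andP/andP => -[lin /eqP pj].
  have pj' := down _ lin pj; rewrite -posy pj' eqxx; split=> //.
  rewrite -(swapK x y L) swapC; apply: linext_swap => //; last by rewrite pj pj'.
  by rewrite comparable_sym.
have pj' := up _ lin pj; rewrite posx pj' eqxx; split=> //.
by apply: linext_swap; rewrite // pj' pj.
Qed.

Lemma Nq_swap_in C x y j : uniq C -> x \in C -> y \notin C ->
  swappable x y j -> Nq C x j.+1 = 'X * Nq C x j.
Proof.
move=> uC xC yC sw; rewrite (Nq_swap C sw) /Nq big_distrr /=.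
apply: eq_bigr => L /andP[lin /eqP pj]; case: sw => _ _ /(_ L lin pj) pj'.
have := wgt_swap L uC xC yC; rewrite pj pj' addnS -addSn => /addIn ->.
by rewrite exprS.
Qed.

(** Here [y] carries the weight and moves down when [x] moves up, so the factor ['X] changes
    sides. *)
Lemma Nq_swap_notin C x y j : uniq C -> x \notin C -> y \in C ->
  swappable x y j -> Nq C x j = 'X * Nq C x j.+1.
Proof.
move=> uC xC yC sw; rewrite (Nq_swap C sw) /Nq big_distrr /=.
apply: eq_bigr => L /andP[lin /eqP pj]; case: sw => _ _ /(_ L lin pj) pj'.
have := wgt_swap L uC yC xC; rewrite pj pj' addnS -addSn swapC => /addIn <-.
by rewrite exprS.
Qed.

Lemma horner1_Nq C x j : (Nq C x j).[1] = (N x j)%:R.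
Proof.
rewrite /Nq horner_sum; under eq_bigr do rewrite hornerXn expr1n.
by rewrite sumr_const /N cardsE.
Qed.

Local Close Scope ring_scope.

(** The pentagon pins the neighbours of [x]: it exchanges places with [y] between [k - 1] and [k],
    and with [z] between [k] and [k + 1]. *)
Lemma pentagon_swappable C D x r k :
  chain_partition C D -> pentagon C D x r k ->
  x \in C /\ exists y z j, [/\ k = j.+1, y \in D, z \in D, swappable x y j
                          & swappable x z j.+1].
Proof.
move=> cp [p [s [y [z [[Cx Cp Cs Dy Dz] [lt_py lt_yz lt_zs inc_xy inc_xz]]]]]].
have [c [Er hc Ex]] := hat_nth_Elt x Cx.
have [j [Ej hj Ey]] := hat_nth_Elt x Dy.
have [j' [Ej' hj' Ez]] := hat_nth_Elt x Dz.
move: Ej'; rewrite Ej => -[Ej'].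
have Ek : k = (c + j.+1).+1 by lia.
have xC : x \in C by rewrite Ex mem_nth.
have sC : sorted <%O%O C by case: cp.
(* [prev] and [next] are stated for a general [w] because each is applied to both [y] and [z]; at an
   end of [C] the segment is empty. *)
have prev w : (y <= w)%O -> {in take c C, forall v, v < w}%O.
  move=> le_yw v; case: c Er hc {Ex Ek} => [|c] Er hc; first by rewrite take0.
  move: Cp; rewrite Er (hat_nth_nth x (ltnW hc)) => -[Ep].
  move: lt_py; rewrite -Ep => /= lt_cy vC; apply: lt_le_trans le_yw.
  move: vC; rewrite (take_nth x (ltnW hc)) mem_rcons inE => /predU1P[-> // | vC].
  apply: lt_trans lt_cy; apply: (sorted_take_drop lt_trans sC vC).
  by rewrite (drop_nth x (ltnW hc)) mem_head.
have next w : (w <= z)%O -> {in drop c.+1 C, forall v, w < v}%O.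
  move=> le_wz v; have [hc1 | hc1] := ltnP c.+1 (size C); last first.
    by rewrite drop_oversize.
  move: Cs; rewrite Er (hat_nth_nth x hc1) => -[Es].
  move: lt_zs; rewrite -Es => /= lt_zc vC; apply: (le_lt_trans le_wz).
  move: vC; rewrite (drop_nth x hc1) inE => /predU1P[-> // | vC].
  apply: (lt_trans lt_zc); apply: (sorted_take_drop lt_trans sC _ vC).
  by rewrite (take_nth x hc1) mem_rcons mem_head.
split=> //; exists y, z, (c + j.+1); split=> //.
- by rewrite Ey mem_nth.
- by rewrite Ez mem_nth.
- split=> // L lin pj.
    have := linext_pos_prev cp Ex hc lin _ hj Ey (prev _ (lexx _)).
    by rewrite pj => /(_ erefl) [].
  rewrite -pj.
  apply: (linext_pos_next cp Ex hc lin _ hj Ey (next _ (ltW lt_yz))).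
  by rewrite pj addnS.
- split=> // L lin pj.
    have := linext_pos_prev cp Ex hc lin _ hj' Ez (prev _ (ltW lt_yz)).
    by rewrite pj -Ej' !addSn !addnS => /(_ erefl)/eq_add_S <-.
  rewrite -pj.
  apply: (linext_pos_next cp Ex hc lin _ hj' Ez (next _ (lexx _))).
  by rewrite pj -Ej'.
Qed.

End Swap.

(** * Ratios of the [q]-counts and specialization at [q = 1] *)

Local Open Scope ring_scope.

Lemma tofrac_qfracP (P Q : {poly int}) :
  (tofrac P = qfrac * tofrac Q) <-> P = 'X * Q.
Proof.
split=> [|->]; last by rewrite rmorphM.
by rewrite /qfrac -rmorphM => /eqP; rewrite tofrac_eq => /eqP.
Qed.

Lemma tofrac_qfracVP (P Q : {poly int}) :
  (tofrac P = qfrac^-1 * tofrac Q) <-> Q = 'X * P.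
Proof.
have q0 : qfrac != 0 by rewrite tofrac_eq0 polyX_eq0.
rewrite -tofrac_qfracP; split=> ->; first by rewrite mulVKf.
by rewrite mulKf.
Qed.

Section Ratios.

Variables (d : Order.disp_t) (X : finPOrderType d) (C D : seq X) (x : X).
Variable k : nat.

(* Condition (d) with denominators cleared. *)
Definition Nq_ratio : Prop :=
  if x \in C
  then Nq C x k = 'X * Nq C x (k - 1) /\ Nq C x (k + 1) = 'X * Nq C x k
  else Nq C x (k - 1) = 'X * Nq C x k /\ Nq C x k = 'X * Nq C x (k + 1).

Lemma Nq_ratioP : Nq_ratio <->
  (tofrac (Nq C x k) = qfrac ^ eps C x * tofrac (Nq C x (k - 1))) /\
  (tofrac (Nq C x k) = qfrac ^ (- eps C x) * tofrac (Nq C x (k + 1))).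
Proof.
rewrite /Nq_ratio /eps; case: ifP => _; rewrite ?opprK ?expr1z ?exprN1;
  by rewrite tofrac_qfracP tofrac_qfracVP.
Qed.

Lemma Nq_ratio_sqr : Nq_ratio ->
  Nq C x k ^+ 2 = Nq C x (k - 1) * Nq C x (k + 1).
Proof.
rewrite /Nq_ratio; case: ifP => _ [E1 E2].
  by rewrite E2 expr2 {1}E1 mulrCA mulrA.
by rewrite E1 expr2 {2}E2 mulrCA mulrA.
Qed.

Lemma Nq_ratio_N : Nq_ratio ->
  N x k = N x (k + 1) /\ N x (k + 1) = N x (k - 1).
Proof.
(* At [q = 1] the factor ['X] becomes [1] and [Nq] becomes [N]. *)
have eqN i j : Nq C x i = 'X * Nq C x j -> N x i = N x j.
  move/(congr1 (horner^~ 1)); rewrite hornerM hornerX mul1r !horner1_Nq.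
  by move=> /eqP; rewrite !natz => /eqP[].
by rewrite /Nq_ratio; case: ifP => _ [/eqN E1 /eqN E2]; split; congruence.
Qed.

Lemma Nq_sqr_N : Nq C x k ^+ 2 = Nq C x (k - 1) * Nq C x (k + 1) ->
  (N x k ^ 2 = N x (k - 1) * N x (k + 1))%N.
Proof.
rewrite expr2 => /(congr1 (horner^~ 1)); rewrite /= !hornerM !horner1_Nq.
by rewrite -!natrM !natz => -[].
Qed.

Hypothesis cp : chain_partition C D.

Lemma pentagon_Nq_ratio : pentagon_property C D x k -> Nq_ratio.
Proof.
have := chain_partition_uniq cp; rewrite cat_uniq => /and3P[uC _ uD].
case=> r [/(pentagon_swappable cp) | /(pentagon_swappable (chain_partitionC cp))].
  move=> [xC [y [z [j [Ek yD zD swy swz]]]]].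
  rewrite /Nq_ratio xC Ek subn1 addn1.
  rewrite !(chain_partition_mem _ cp) in yD zD.
  by split; [exact: Nq_swap_in swy | exact: Nq_swap_in swz].
move=> [xD [y [z [j [Ek yC zC swy swz]]]]].
rewrite (chain_partition_mem _ cp) in xD.
rewrite /Nq_ratio (negbTE xD) Ek subn1 addn1.
by split; [exact: Nq_swap_notin swy | exact: Nq_swap_notin swz].
Qed.

Lemma sqr_N_pentagon_property : (0 < N x k)%N ->
  (N x k ^ 2 = N x (k - 1) * N x (k + 1))%N -> pentagon_property C D x k.
Proof.
move=> Nk eqN; have [xC | xC] := boolP (x \in C).
  exists (index x C).+1; left.
  by apply: sqr_N_pentagon; rewrite ?nth_index ?index_mem.
exists (index x D).+1; right.
have xD : x \in D by rewrite (chain_partition_mem _ cp).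
by apply: (sqr_N_pentagon (chain_partitionC cp)); rewrite ?nth_index ?index_mem.
Qed.

End Ratios.

Local Close Scope ring_scope.

Theorem theorem1p6 (d : Order.disp_t) (X : finPOrderType d) (C1 C2 : seq X)
    (hwidth : width X = 2) (hpart : chain_partition C1 C2)
    (x : X) (k : nat) (hk : 1 <= k <= #|X| - 1) (hN : 0 < N x k) :
  [<-> N x k ^ 2 = N x (k - 1) * N x (k + 1);
       N x k = N x (k + 1) /\ N x (k + 1) = N x (k - 1);
       (Nq C1 x k ^+ 2 = Nq C1 x (k - 1) * Nq C1 x (k + 1))%R;
       (tofrac (Nq C1 x k) = qfrac ^ eps C1 x * tofrac (Nq C1 x (k - 1)))%R /\
       (tofrac (Nq C1 x k) = qfrac ^ (- eps C1 x) * tofrac (Nq C1 x (k + 1)))%R;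
       pentagon_property C1 C2 x k].
Proof.
have sqr_ratio : N x k ^ 2 = N x (k - 1) * N x (k + 1) -> Nq_ratio C1 x k.
  by move=> /(sqr_N_pentagon_property hpart hN)/(pentagon_Nq_ratio hpart).
have N_sqr : N x k = N x (k + 1) /\ N x (k + 1) = N x (k - 1) ->
    N x k ^ 2 = N x (k - 1) * N x (k + 1).
  by case=> -> ->; rewrite expnS expn1.
(* Equality in (a) yields the pentagon, hence the ratios; setting [q = 1] leads back to (b) and (a).
   Each arrow of the cycle is a segment of this loop. *)
tfae.
- by move=> /sqr_ratio/Nq_ratio_N.
- by move=> /N_sqr/sqr_ratio/Nq_ratio_sqr.
- by move=> /Nq_sqr_N/sqr_ratio/Nq_ratioP.
- by move=> /Nq_ratioP/Nq_ratio_N/N_sqr/(sqr_N_pentagon_property hpart hN).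
- by move=> /(pentagon_Nq_ratio hpart)/Nq_ratio_N/N_sqr.
Qed.
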